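(* For real $y\ge 2$ we have $$ \mathcal{S}_y = \bigcap_{i\ge 0} \mathcal{D}_{i,y}= \bigcap_{i\ge 0} \mathcal{D}^*_{i,y} . $$
   Context: $\mathbb{N}=\{1,2,\ldots\}$. $\mathcal{S}_y$ is the set of natural numbers all of whose prime factors are $\le y$. A finite increasing sequence of natural numbers is called $y$-dense if the ratios of consecutive terms are all $\le y$. Define $\mathcal{D}_{0,y}=\mathbb{N}$. For $i\ge 1$, $n\in \mathcal{D}_{i,y}$ if and only if the increasing sequence $\{d: d|n,\ d\in \mathcal{D}_{i-1,y}\}$ is a $y$-dense sequence containing $1$ and $n$. Define $\mathcal{D}^*_{0,y}=\mathbb{N}$. For $i\ge 1$, $n\in \mathcal{D}^*_{i,y}$ if and only if for each $j$ with $0\le j \le i-1$, the increasing sequence $\{d: d|n,\ d\in \mathcal{D}^*_{j,y} \text{ and } n/d \in \mathcal{D}^*_{i-1-j,y} \}$ is a $y$-dense sequence containing $1$ and $n$. *)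

(* Defs.v *)
(* The natural numbers start at 1 here: every predicate on nat defined below
   is false at 0. *)
From mathcomp Require Import all_boot all_order all_algebra.
From mathcomp Require Import boolp classical_sets reals.

Set Implicit Arguments.
Unset Strict Implicit.
Unset Printing Implicit Defensive.

Import Order.TTheory GRing.Theory Num.Theory.

Local Open Scope ring_scope.

Definition smooth (R : realType) (y : R) : pred nat :=
  fun n => (0 < n)%N && all (fun p : nat => p%:R <= y) (primes n).

Definition y_dense (R : realType) (y : R) (s : seq nat) : bool :=
  sorted (fun a b : nat => (a < b)%N && (b%:R / a%:R <= y)) s.

Definition y_dense_from_to (R : realType) (y : R) (n : nat) (s : seq nat) :
  bool := [&& y_dense y s, 1%N \in s & n \in s].

(* [divisors n] lists the divisors of n > 0 in increasing order. *)
Fixpoint D (R : realType) (y : R) (i : nat) : pred nat :=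
  if i is k.+1 then
    fun n => (0 < n)%N && y_dense_from_to y n [seq d <- divisors n | D y k d]
  else fun n => (0 < n)%N.

(* The passage from levels 0, ..., k to level k + 1. *)
Definition Dstar_step (R : realType) (y : R) (k : nat) (E : nat -> pred nat) :
  pred nat :=
  fun n => (0 < n)%N &&
    [forall j : 'I_k.+1,
      y_dense_from_to y n [seq d <- divisors n | E j d && E (k - j)%N (n %/ d)%N]].

(* The recursion for Dstar uses all lower levels, so they are tabulated:
   [Dstar_table y i] is the list of levels 0, ..., i. The resulting
   course-of-values equations are Dstar0 and DstarS. *)
Fixpoint Dstar_table (R : realType) (y : R) (i : nat) : seq (pred nat) :=
  if i is k.+1 then
    let t := Dstar_table y k in rcons t (Dstar_step y k (nth xpred0 t))
  else [:: fun n => (0 < n)%N].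

Definition Dstar (R : realType) (y : R) (i : nat) : pred nat :=
  nth xpred0 (Dstar_table y i) i.

Lemma size_Dstar_table (R : realType) (y : R) i :
  size (Dstar_table y i) = i.+1.
Proof. by elim: i => //= i IH; rewrite size_rcons IH. Qed.

Lemma nth_Dstar_table (R : realType) (y : R) i j :
  (j <= i)%N -> nth xpred0 (Dstar_table y i) j = Dstar y j.
Proof.
elim: i => [|i IH]; first by rewrite leqn0 => /eqP ->.
rewrite leq_eqVlt => /predU1P[-> //|ji].
by rewrite /= nth_rcons size_Dstar_table ji IH.
Qed.

Lemma Dstar0 (R : realType) (y : R) n : Dstar y 0 n = (0 < n)%N.
Proof. by []. Qed.

Lemma DstarS (R : realType) (y : R) k n :
  Dstar y k.+1 n =
  (0 < n)%N &&
    [forall j : 'I_k.+1,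
      y_dense_from_to y n
        [seq d <- divisors n | Dstar y j d && Dstar y (k - j) (n %/ d)%N]].
Proof.
rewrite {1}/Dstar /= nth_rcons size_Dstar_table ltnn eqxx /Dstar_step.
congr andb; apply: eq_forallb => j; congr y_dense_from_to.
apply: eq_filter => d.
by rewrite !nth_Dstar_table ?leq_subr // -ltnS.
Qed.

(* Main.v *)
(* In the divisor list of a y-smooth n, every d < n is followed by at most d * p
   for a prime p dividing n / d, so the list is y-dense; by induction every level
   of both hierarchies contains all y-smooth numbers.
   Conversely, let n be non-smooth with a y-dense list of divisors containing 1
   and n. The list steps somewhere from a smooth a to a non-smooth b. This b is
   not n: a prime q > y dividing n does not divide a, so n / a >= q > y. Hence a
   non-smooth member of level i + 1 has a smaller non-smooth divisor in level i
   (for Dstar use j = i), and a non-smooth member of level i exceeds i. *)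
Require Import Defs.
From mathcomp Require Import all_boot all_order all_algebra.
From mathcomp Require Import boolp classical_sets reals.

Import Order.TTheory GRing.Theory Num.Theory.

Local Open Scope classical_set_scope.
Local Open Scope ring_scope.

Lemma smoothP (R : realType) (y : R) n : (0 < n)%N ->
  reflect (forall p, prime p -> (p %| n)%N -> p%:R <= y) (smooth y n).
Proof.
move=> n0; rewrite /smooth n0 /=; apply: (iffP allP) => h p.
  by move=> pp pn; apply: h; rewrite mem_primes pp n0.
by rewrite mem_primes => /and3P[pp _ pn]; apply: h.
Qed.

Lemma dvdn_smooth (R : realType) (y : R) d n :
  (d %| n)%N -> smooth y n -> smooth y d.
Proof.
move=> dn sn; have n0 : (0 < n)%N by case/andP: sn.
apply/(smoothP _ _ _ (dvdn_gt0 n0 dn)) => p pp pd.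
by apply: (smoothP _ _ _ n0 sn) => //; apply: dvdn_trans dn.
Qed.

Lemma smooth_divisors_dense (R : realType) (y : R) n :
  smooth y n -> y_dense y (divisors n).
Proof.
move=> sn; have n0 : (0 < n)%N by case/andP: sn.
apply/(sortedP 0%N) => i hi.
set a := nth _ _ i; set b := nth _ _ i.+1.
have nthle j k : (j <= k)%N -> (k < size (divisors n))%N ->
    (nth 0 (divisors n) j <= nth 0 (divisors n) k)%N.
  move=> jk ks; have js := leq_ltn_trans jk ks.
  exact: (sorted_leq_nth leq_trans leqnn 0%N (sorted_divisors n)).
have ab : (a < b)%N.
  by apply: (sorted_ltn_nth ltn_trans 0%N (sorted_divisors_ltn n)) => //; apply: ltnW.
have an : (a %| n)%N by rewrite dvdn_divisors// mem_nth// ltnW.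
have bn : (b %| n)%N by rewrite dvdn_divisors// mem_nth.
have a0 : (0 < a)%N := dvdn_gt0 n0 an.
rewrite ab /=.
have na1 : (1 < n %/ a)%N.
  by rewrite ltn_divRL// mul1n (leq_trans ab)// dvdn_leq.
set p := pdiv (n %/ a).
have pp : prime p by apply: pdiv_prime.
have pan : (p * a %| n)%N by rewrite -dvdn_divRL// pdiv_dvd.
have py : p%:R <= y.
  by apply: (smoothP _ _ _ n0 sn) => //; apply: dvdn_trans pan; apply: dvdn_mulr.
(* The divisor [p * a] sits in the list at some index [k]. As it exceeds [a], [k] is past [i], hence
   at least the index of [b]. *)
have bpa : (b <= p * a)%N.
  have : (p * a \in divisors n)%N by rewrite -dvdn_divisors.
  case/(nthP 0%N) => k ks kE; rewrite -kE.
  case: (leqP i.+1 k) => [ik|ki]; first exact: nthle.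
  have : (p * a <= a)%N by rewrite -kE nthle// ltnW.
  by rewrite leqNgt ltn_Pmull ?prime_gt1.
apply: le_trans py; rewrite ler_pdivrMr ?ltr0n//.
by rewrite -natrM ler_nat.
Qed.

(** The filter removes nothing, so density of the full divisor list applies. [E] is arbitrary in
    order to serve both hierarchies. *)
Lemma smooth_dense_from_to (R : realType) (y : R) n (E : pred nat) :
  smooth y n -> (forall d, (d %| n)%N -> E d) ->
  y_dense_from_to y n [seq d <- divisors n | E d].
Proof.
move=> sn En; have n0 : (0 < n)%N by case/andP: sn.
have -> : [seq d <- divisors n | E d] = divisors n.
  by apply/all_filterP/allP => d; rewrite -dvdn_divisors// => /En.
by rewrite /y_dense_from_to smooth_divisors_dense// -!dvdn_divisors// dvd1n dvdnn.
Qed.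

Lemma smooth_D (R : realType) (y : R) i n : smooth y n -> D y i n.
Proof.
elim: i n => [|i IH] n sn; first by case/andP: sn.
have n0 : (0 < n)%N by case/andP: sn.
rewrite /= n0 smooth_dense_from_to// => d dn.
exact/IH/(dvdn_smooth _ _ _ _ dn).
Qed.

Lemma smooth_Dstar (R : realType) (y : R) i n : smooth y n -> Dstar y i n.
Proof.
(* Strong induction, since level [i.+1] refers to the levels [j] and [i - j] for all [j <= i]. *)
elim/ltn_ind: i n => -[_|i IH] n sn; first by case/andP: sn.
have n0 : (0 < n)%N by case/andP: sn.
rewrite DstarS n0 /=; apply/forallP => j.
apply: smooth_dense_from_to => // d dn; apply/andP; split; apply: IH => //.
- exact: dvdn_smooth sn.
- by rewrite ltnS leq_subr.
- exact: dvdn_smooth (dvdn_div dn) sn.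
Qed.

(** Take for [b] the first entry failing [P] and for [a] its predecessor, possibly the head [x]. *)
Lemma path_exit (T : eqType) (e : rel T) (P : pred T) x s :
  path e x s -> P x -> has (predC P) s ->
  exists a b, [/\ a \in x :: s, b \in s, e a b, P a & ~~ P b].
Proof.
elim: s x => //= z s IH x /andP[exz es] Px.
have [Pz /= hs|nPz _] := boolP (P z); last by exists x, z; rewrite !mem_head.
have [a [b [az bs eab Pa Pb]]] := IH z es Pz hs.
by exists a, b; split=> //; rewrite in_cons ?az ?bs orbT.
Qed.

Lemma dense_nonsmooth_divisor (R : realType) (y : R) n (E : pred nat) :
  (0 < n)%N -> ~~ smooth y n ->
  y_dense_from_to y n [seq d <- divisors n | E d] ->
  exists d, [/\ (d < n)%N, E d & ~~ smooth y d].
Proof.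
move=> n0 nsn /and3P[]; set s := filter _ _ => ds s1 sn.
have sP d : d \in s -> (d %| n)%N && E d.
  by rewrite mem_filter -dvdn_divisors// andbC.
case: s => [//|x s] in ds s1 sn sP *.
(* The list increases strictly, contains 1 and has positive entries, so it starts at 1, which is
   smooth. *)
have x1 : x = 1%N.
  have /andP[xn _] := sP x (mem_head _ _).
  have : path ltn x s by apply: sub_path ds => u v /andP[].
  move/(order_path_min ltn_trans)/allP => minx.
  move: s1; rewrite in_cons => /predU1P[//|/minx].
  by rewrite /= ltnNge (dvdn_gt0 n0 xn).
have ns : n \in s.
  move: sn; rewrite in_cons => /predU1P[nx|//].
  by move: nsn; rewrite nx x1.
have [||a [b [ax bs /andP[ab bay] sa nsb]]] := path_exit _ _ (smooth y) _ _ ds.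
- by rewrite x1.
- by apply/hasP; exists n.
have /andP[an _] := sP _ ax.
have /andP[bn Eb] : (b %| n)%N && E b by apply: sP; rewrite in_cons bs orbT.
have a0 : (0 < a)%N := dvdn_gt0 n0 an.
exists b; split=> //; rewrite ltn_neqAle dvdn_leq// andbT.
(* If [b = n], each prime [q] dividing [n] divides either the smooth [a] or the quotient [n %/ a],
   which is at most [y]; then [n] would be smooth. *)
apply/eqP => bE; move/negP: nsn; apply; apply/(smoothP _ _ _ n0) => q pq qn.
have [qa|qa] := boolP (q %| a)%N; first exact: (smoothP _ _ _ a0 sa).
have qna : (q %| n %/ a)%N.
  by move: qn; rewrite -{1}(divnK an) Euclid_dvdM// (negbTE qa) orbF.
have na0 : (0 < n %/ a)%N by rewrite divn_gt0// dvdn_leq.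
apply: le_trans bay; rewrite ler_pdivlMr ?ltr0n// bE -natrM ler_nat.
by rewrite -leq_divRL// dvdn_leq.
Qed.

Lemma nonsmooth_D_gt (R : realType) (y : R) i n :
  D y i n -> ~~ smooth y n -> (i < n)%N.
Proof.
elim: i n => [//|i IH] n /andP[n0 dn] nsn.
have [d [dltn Dd nsd]] := dense_nonsmooth_divisor _ _ _ _ n0 nsn dn.
exact: leq_ltn_trans (IH d Dd nsd) dltn.
Qed.

Lemma nonsmooth_Dstar_gt (R : realType) (y : R) i n :
  Dstar y i n -> ~~ smooth y n -> (i < n)%N.
Proof.
(* [ord_max] is the choice [j = i], which puts the divisors [d] in level [i]. *)
elim: i n => [//|i IH] n; rewrite DstarS => /andP[n0 /forallP/(_ ord_max) dn] nsn.
have [d [dltn /andP[Dd _] nsd]] := dense_nonsmooth_divisor _ _ _ _ n0 nsn dn.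
exact: leq_ltn_trans (IH d Dd nsd) dltn.
Qed.

(** A non-smooth [n] in every level would lie in level [n], forcing [n < n]. *)
Lemma smooth_bigcap (R : realType) (y : R) (E : nat -> pred nat) :
  (forall i n, smooth y n -> E i n) ->
  (forall i n, E i n -> ~~ smooth y n -> (i < n)%N) ->
  [set n : nat | smooth y n] = \bigcap_(i : nat) [set n : nat | E i n].
Proof.
move=> sE Egt; apply/seteqP; split=> n /= => [sn i _|En]; first exact: sE.
apply/negPn/negP => nsn.
by have := Egt n n (En n I) nsn; rewrite ltnn.
Qed.

Theorem corollary1 (R : realType) (y : R) (hy : 2 <= y) :
  [set n : nat | smooth y n] = \bigcap_(i : nat) [set n : nat | D y i n] /\
  \bigcap_(i : nat) [set n : nat | D y i n] =
    \bigcap_(i : nat) [set n : nat | Dstar y i n].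
Proof.
have SD := smooth_bigcap _ _ _ (smooth_D R y) (nonsmooth_D_gt R y).
by split=> //; rewrite -SD; apply: smooth_bigcap;
  [exact: smooth_Dstar | exact: nonsmooth_Dstar_gt].
Qed.
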